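(* Let $(N,D,K,H,B,P)$ be a setup-inventory situation (SI-situation) and let $(N,c)$ be the associated setup-inventory game (SI-game). Then $(N,c)$ is balanced; that is, for every collection $\mathcal{B}$ of nonempty coalitions of $N$ and all nonnegative weights $\{\lambda_S\}_{S\in\mathcal{B}}$ with $\sum_{S\in\mathcal{B}:\, i\in S}\lambda_S=1$ for all $i\in N$, one has $$\sum_{S\in\mathcal{B}}\lambda_S\, c(S)\ \ge\ c(N).$$
   Context: Let $T\ge 1$ be the number of periods. A setup-inventory situation (SI-situation) is a tuple $(N,D,K,H,B,P)$ where $N=\{1,\dots,n\}$ is a finite set of players and $D,K,H,B,P$ are $n\times T$ matrices with nonnegative entries. Row $i$ of them is, respectively, the demand vector $(d^i_1,\dots,d^i_T)$ (integers), the setup costs $(k^i_t)_t$, the unit inventory carrying costs $(h^i_t)_t$, the unit backlogging costs $(b^i_t)_t$, and the unit purchasing costs $(p^i_t)_t$ of player $i$ (real numbers). For a nonempty coalition $S\subseteq N$ put, for each $t=1,\dots,T$, $$p_t^S=\min_{i\in S}p_t^i,\quad h_t^S=\min_{i\in S}h_t^i,\quad b_t^S=\min_{i\in S}b_t^i,\quad k_t^S=\min_{i\in S}k_t^i,\quad d_t^S=\sum_{i\in S}d_t^i .$$ The associated SI-game is the cost TU-game $(N,c)$ with $c(\varnothing)=0$ and, for nonempty $S\subseteq N$, $c(S)$ equal to the optimal value of $$\min \sum_{t=1}^{T}\bigl(p_t^S q_t+h_t^S I_t+b_t^S E_t+k_t^S\gamma(q_t)\bigr)$$ subject to $I_0=I_T=E_0=E_T=0$,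 $\ I_t-E_t=I_{t-1}-E_{t-1}+q_t-d_t^S$ for $t=1,\dots,T$, and $q_t,I_t,E_t$ nonnegative integers for $t=1,\dots,T$. Here $\gamma(q)=1$ if $q>0$ and $\gamma(0)=0$. *)

(* Defs.v *)
From HB Require Import structures.
From mathcomp Require Import boolp classical_sets reals.
From mathcomp Require Import all_boot all_order all_algebra.

Set Implicit Arguments.
Unset Strict Implicit.
Unset Printing Implicit Defensive.

Import Order.TTheory GRing.Theory Num.Theory.
Local Open Scope ring_scope.

(* Players are 'I_n and periods are 'I_T: the ordinal t : 'I_T stands for the
   period t + 1. *)
Record si_situation (R : realType) (n T : nat) := SISituation {
  demand : 'M[nat]_(n, T);
  setup : 'M[R]_(n, T);
  holding : 'M[R]_(n, T);
  backlog : 'M[R]_(n, T);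
  purchase : 'M[R]_(n, T);
  setup_ge0 : forall i t, 0 <= setup i t;
  holding_ge0 : forall i t, 0 <= holding i t;
  backlog_ge0 : forall i t, 0 <= backlog i t;
  purchase_ge0 : forall i t, 0 <= purchase i t }.

(* For nonempty S, [pick j in S] only provides an element of S to start the
   iterated minimum; the value 0 for S = set0 is a junk value. *)
Definition coalition_min (R : realType) (n T : nat) (A : 'M[R]_(n, T))
    (S : {set 'I_n}) (t : 'I_T) : R :=
  if [pick j in S] is Some j then \big[Order.min/A j t]_(i in S) A i t else 0.

Definition coalition_demand (R : realType) (n T : nat)
    (s : si_situation R n T) (S : {set 'I_n}) (t : 'I_T) : nat :=
  (\sum_(i in S) demand s i t)%N.

(* Inventories and backlogs are recorded at the times 0, ..., T.  The two
   functions below give the times at the beginning and at the end of t. *)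
Definition time_before (T : nat) (t : 'I_T) : 'I_T.+1 := widen_ord (leqnSn T) t.
Definition time_after (T : nat) (t : 'I_T) : 'I_T.+1 := lift ord0 t.

Record plan (T : nat) := Plan {
  order_qty : 'I_T -> nat;
  inventory : 'I_T.+1 -> nat;
  backlogged : 'I_T.+1 -> nat }.

Definition feasible (R : realType) (n T : nat) (s : si_situation R n T)
    (S : {set 'I_n}) (x : plan T) : Prop :=
  [/\ inventory x ord0 = 0%N /\ inventory x ord_max = 0%N,
      backlogged x ord0 = 0%N /\ backlogged x ord_max = 0%N &
      forall t : 'I_T,
        (inventory x (time_after t))%:Z - (backlogged x (time_after t))%:Z =
        (inventory x (time_before t))%:Z - (backlogged x (time_before t))%:Z
        + (order_qty x t)%:Z - (coalition_demand s S t)%:Z].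

Definition gamma (q : nat) : nat := if (0 < q)%N then 1%N else 0%N.

Definition plan_cost (R : realType) (n T : nat) (s : si_situation R n T)
    (S : {set 'I_n}) (x : plan T) : R :=
  \sum_(t < T)
    (coalition_min (purchase s) S t * (order_qty x t)%:R
     + coalition_min (holding s) S t * (inventory x (time_after t))%:R
     + coalition_min (backlog s) S t * (backlogged x (time_after t))%:R
     + coalition_min (setup s) S t * (gamma (order_qty x t))%:R).

(* The optimal value is written as an infimum; by si_game_attained below it is
   a minimum. *)
Definition si_game (R : realType) (n T : nat) (s : si_situation R n T)
    (S : {set 'I_n}) : R :=
  if S == set0 then 0
  else inf [set v : R | exists2 x : plan T,
                          feasible s S x & v = plan_cost s S x]%classic.

Definition balanced (R : realType) (n : nat) (c : {set 'I_n} -> R) : Prop :=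
  forall (B : {set {set 'I_n}}) (lambda : {set 'I_n} -> R),
    set0 \notin B ->
    (forall S, S \in B -> 0 <= lambda S) ->
    (forall i : 'I_n, \sum_(S in B | i \in S) lambda S = 1) ->
    \sum_(S in B) lambda S * c S >= c [set: 'I_n].

Lemma coalition_minP (R : realType) (n T : nat) (A : 'M[R]_(n, T))
    (S : {set 'I_n}) (t : 'I_T) :
  S != set0 ->
  (exists2 i, i \in S & coalition_min A S t = A i t) /\
  (forall i, i \in S -> coalition_min A S t <= A i t).
Proof.
move=> /set0Pn[i0 i0S]; rewrite /coalition_min; case: pickP => [j jS|/(_ i0)].
  split=> [|i iS]; last exact: bigmin_le_cond.
  apply: (big_ind (fun v => exists2 i, i \in S & v = A i t)).
  - by exists j.
  - move=> _ _ [i iS ->] [k kS ->].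
    by case: (leP (A i t) (A k t)) => _; [exists i | exists k].
  - by move=> i iS; exists i.
by rewrite i0S.
Qed.

Lemma nat_combination_attains_min (R : realType) (J : finType) (a : J -> R)
    (P : (J -> nat) -> Prop) :
  (forall j, 0 <= a j) -> (exists w, P w) ->
  exists2 w, P w &
    forall w', P w' -> \sum_j a j * (w j)%:R <= \sum_j a j * (w' j)%:R.
Proof.
move=> a0 [w0 Pw0]; pose f w : R := \sum_j a j * (w j)%:R.
have [b0 hb] : exists b : nat, forall j, 0 < a j -> f w0 < a j * b%:R.
  exists (\sum_j Num.bound (f w0 / a j))%N => j aj.
  rewrite mulrC -ltr_pdivrMr//.
  have q0 : 0 <= f w0 / a j.
    by rewrite divr_ge0// sumr_ge0// => k _; rewrite mulr_ge0.
  by rewrite (lt_le_trans (archi_boundP q0))// ler_nat (bigD1 j)//= leq_addr.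
pose g (y : {ffun J -> 'I_b0.+1}) := f (fun j => y j).
pose Q (y : {ffun J -> 'I_b0.+1}) := `[< exists2 w, P w & f w = g y >].
have trunc w : f w <= f w0 ->
    f w = g [ffun j => inord (minn b0 (w j))].
  move=> le; apply: eq_bigr => j _; rewrite ffunE inordK ?ltnS ?geq_minl//.
  have [aj|] := ltP 0 (a j); last first.
    by move=> aj; have -> : a j = 0; [apply/le_anti; rewrite aj a0 | rewrite !mul0r].
  congr (_ * _%:R); apply/esym/minn_idPr.
  have : a j * (w j)%:R < a j * b0%:R.
    apply: le_lt_trans (hb j aj); apply: le_trans le.
    by rewrite /f (bigD1 j)//= lerDl sumr_ge0// => k _; rewrite mulr_ge0.
  by rewrite ltr_pM2l// ltr_nat => /ltnW.
have Q0 : Q [ffun j => inord (minn b0 (w0 j))].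
  by apply/asboolP; exists w0; rewrite // -trunc.
case: (Order.TotalTheory.arg_minP g Q0) => y /asboolP[w Pw fw] ymin.
exists w => // w' Pw'; rewrite -/(f w) -/(f w') fw.
have [le|lt] := leP (f w') (f w0).
  by rewrite (trunc _ le); apply: ymin; apply/asboolP; exists w'; rewrite // -trunc.
by apply: ltW; apply: le_lt_trans lt; rewrite (trunc w0)//; exact: ymin.
Qed.

Lemma si_game_attained (R : realType) (n T : nat) (s : si_situation R n T)
    (S : {set 'I_n}) :
  S != set0 ->
  exists2 x, feasible s S x &
    si_game s S = plan_cost s S x /\
    forall y, feasible s S y -> plan_cost s S x <= plan_cost s S y.
Proof.
move=> S0.
have ge0 (A : 'M[R]_(n, T)) t :
    (forall i t, 0 <= A i t) -> 0 <= coalition_min A S t.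
  by move=> A0; have [[i _ ->] _] := coalition_minP A t S0.
pose pick4 (U : Type) (u0 u1 u2 u3 : U) (k : 'I_4) := nth u0 [:: u0; u1; u2; u3] k.
pose a (j : 'I_T * 'I_4) := pick4 R
  (coalition_min (purchase s) S j.1) (coalition_min (holding s) S j.1)
  (coalition_min (backlog s) S j.1) (coalition_min (setup s) S j.1) j.2.
pose w (x : plan T) (j : 'I_T * 'I_4) := pick4 nat
  (order_qty x j.1) (inventory x (time_after j.1))
  (backlogged x (time_after j.1)) (gamma (order_qty x j.1)) j.2.
have costE x : plan_cost s S x = \sum_j a j * (w x j)%:R.
  rewrite -(pair_bigA _ (fun t k => a (t, k) * (w x (t, k))%:R))/=.
  by apply: eq_bigr => t _; rewrite !big_ord_recl big_ord0 addr0 !addrA.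
have a0 j : 0 <= a j.
  case: j => t [[|[|[|[|//]]]] ?]; rewrite /a /pick4 /=; apply: ge0 => i u.
  - exact: purchase_ge0.
  - exact: holding_ge0.
  - exact: backlog_ge0.
  - exact: setup_ge0.
have [|wm [x fx wmE] xmin] := @nat_combination_attains_min R _ a
    (fun v => exists2 x, feasible s S x & v = w x) a0.
  pose x := Plan (coalition_demand s S) (fun=> 0%N) (fun=> 0%N).
  by exists (w x), x => //; split=> // t; rewrite /= subrr add0r subrr.
have {}xmin y : feasible s S y -> plan_cost s S x <= plan_cost s S y.
  by move=> fy; rewrite !costE -wmE; apply: xmin; exists y.
exists x => //; split=> //; rewrite /si_game (negbTE S0).
have lb : lbound [set v : R | exists2 y, feasible s S y & v = plan_cost s S y]%classic
    (plan_cost s S x) by move=> _ [y fy ->]; exact: xmin.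
apply/le_anti/andP; split.
  by apply: ge_inf; [exists (plan_cost s S x) | exists x].
by apply: lb_le_inf => //; exists (plan_cost s S x), x.
Qed.

(* Main.v *)
Require Import Defs.
From mathcomp Require Import boolp classical_sets.
From mathcomp Require Import all_boot all_order all_algebra.
From mathcomp Require Import reals.
From mathcomp Require Import ring lra zify.

(* View the lot-sizing problem as facility location: serving period u from an
   order placed in period t costs c(t, u) = p_t plus the holding (t < u) or
   backlogging (u < t) costs in between, and k_t is paid once t is open.  For
   the grand coalition N this linear program has no integrality gap: there are
   unit prices y with \sum_u d_u^N (y_u - c(t, u))^+ <= k_t for all t and
   \sum_u d_u^N y_u >= c(N).  As d^S <= d^N and the costs of S dominate those of
   N, the same prices are dual feasible for S, so c(S) >= \sum_u d_u^S y_u;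
   averaging with balanced weights gives the theorem.

   The absence of a gap is Kolen's argument for totally balanced systems.  With
   B_u = \sum_(v < u) b_v, raise all levels y_u + B_u simultaneously and freeze u
   when it reaches a facility whose dual constraint is tight.  Then open tight
   facilities greedily in the order of increasing p_t - \sum_(v < t) h_v,
   skipping those sharing a contributor with an open one.  A period whose
   facility was skipped is reached by the one that caused the skip, because
   g(t, u) = c(t, u) + B_u satisfies g(t', u) <= max (g(t, u), g(t', v)) for t'
   before t in that order. *)

Set Implicit Arguments.
Unset Strict Implicit.
Unset Printing Implicit Defensive.

Import Order.TTheory GRing.Theory Num.Theory.
Local Open Scope ring_scope.

(** * Dual ascent for facility location *)

Section DualAscent.
Variables (R : realType) (C J : finType).

Lemma filling_level (w g : C -> R) (U : {set C}) (a k : R) :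
  (forall x, x \in U -> 0 < w x) -> U != set0 -> a <= k ->
  let f m := a + \sum_(x in U) w x * Num.max 0 (m - g x) in
  exists m, [/\ f m = k, exists2 x, x \in U & g x <= m &
                forall m', f m' <= k -> m' <= m].
Proof.
move=> w0 /set0Pn[z zU] ak f.
have term0 m x : x \in U -> 0 <= w x * Num.max 0 (m - g x).
  by move=> xU; apply: mulr_ge0; [exact/ltW/w0|rewrite le_max lexx].
pose x0 := [arg min_(x < z in U) g x]%O.
have [x0U x0min] : x0 \in U /\ forall x, x \in U -> g x0 <= g x.
  by rewrite /x0; case: Order.TotalTheory.arg_minP => // x xU xm; split.
pose E := [set m | f m <= k]%classic.
have Ex0 : E (g x0).
  rewrite /E /= /f big1 ?addr0// => x xU.
  by rewrite (max_idPl _) ?mulr0// subr_le0 x0min.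
have ubE : ubound E (g x0 + (k - a) / w x0).
  move=> m; rewrite /E /= /f (bigD1 x0)//= => fm.
  have : 0 <= \sum_(x in U | x != x0) w x * Num.max 0 (m - g x).
    by apply: sumr_ge0 => x /andP[xU _]; exact: term0.
  have : w x0 * (m - g x0) <= w x0 * Num.max 0 (m - g x0).
    by rewrite ler_pM2l ?w0// le_max lexx orbT.
  move=> h1 h2; rewrite -lerBlDl ler_pdivlMr ?w0//; lra.
have supE : has_sup E by split; [exists (g x0) | exists (g x0 + (k - a) / w x0)].
pose L := \sum_(x in U) w x.
have L0 : 0 < L.
  rewrite /L (bigD1 z)//= ltr_pwDl ?w0// sumr_ge0// => x /andP[xU _].
  exact/ltW/w0.
have fL m e : 0 <= e -> f (m + e) <= f m + L * e.
  move=> e0; rewrite /f -addrA lerD2l /L mulr_suml -big_split /=.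
  apply: ler_sum => x xU; rewrite -mulrDr ler_pM2l ?w0// ge_max.
  by apply/andP; split; case: (leP 0 (m - g x)) => ?; lra.
have fmono m m' : m <= m' -> f m <= f m'.
  move=> mm; rewrite /f lerD2l; apply: ler_sum => x xU.
  by rewrite ler_pM2l ?w0// ge_max !le_max lexx lerD2r mm orbT.
have top m' : E m' -> m' <= sup E by apply: sup_upper_bound.
exists (sup E); split; last exact: top.
- apply/le_anti/andP; split; rewrite leNgt; apply/negP => lt.
  + have e0 : 0 < (f (sup E) - k) / L by rewrite divr_gt0// subr_gt0.
    have [m Em ltm] := sup_adherent e0 supE.
    have := fL m (sup E - m); rewrite subrKC subr_ge0 top// => /(_ isT).
    have : L * (sup E - m) < f (sup E) - k.
      by rewrite mulrC -ltr_pdivlMr//; lra.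
    by move: Em; rewrite /E /=; lra.
  + have e0 : 0 < (k - f (sup E)) / L by rewrite divr_gt0// subr_gt0.
    suff /top : E (sup E + (k - f (sup E)) / L) by lra.
    apply: le_trans (fL _ _ (ltW e0)) _.
    by rewrite mulrC divfK ?gt_eqF//; lra.
- by exists x0 => //; exact: top.
Qed.

Variables (w : C -> R) (g : J -> C -> R) (k : J -> R).

Definition load (s : C -> R) (j : J) : R :=
  \sum_x w x * Num.max 0 (s x - g j x).

(** The last clause lets an open facility that shares a contributor [y] with [j] reach [x]: its cost
    at [y] is below [s y], hence below [s x]. *)
Definition blocked (s : C -> R) (x : C) : Prop :=
  exists j, [/\ load s j = k j, g j x <= s x &
                forall y, g j y < s y -> s y <= s x].

Hypotheses (w_ge0 : forall x, 0 <= w x) (k_ge0 : forall j, 0 <= k j).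

Lemma ler_load (s s' : C -> R) (j : J) :
  (forall x, s x <= s' x) -> load s j <= load s' j.
Proof.
move=> ss'; apply: ler_sum => x _; rewrite ler_wpM2l//.
by rewrite ge_max !le_max lexx lerD2r ss' orbT.
Qed.

(** A strict rise of [x] ending above [g j x] would strictly increase its own term, and no other
    term decreases. *)
Lemma eq_load_contrib (s s' : C -> R) (j : J) (x : C) :
  (forall y, s y <= s' y) -> load s j = load s' j -> 0 < w x ->
  g j x < s' x -> s x = s' x.
Proof.
move=> ss' eqL wx lt; apply/le_anti; rewrite ss' /= leNgt; apply/negP => lts.
have : load s j < load s' j; last by rewrite eqL ltxx.
rewrite /load (bigD1 x)//= [ltRHS](bigD1 x)//=; apply: ltr_leD.
  rewrite ltr_pM2l// gt_max !lt_max ltxx/= subr_gt0 lt/=.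
  by rewrite ltrD2r lts orbT.
apply: ler_sum => y _; rewrite ler_wpM2l//.
by rewrite ge_max !le_max lexx lerD2r ss' orbT.
Qed.

(** A tight load cannot grow, so the contributors of positive weight keep their levels. Clients of
    weight zero are invisible in the load, hence the separate hypothesis on them. *)
Lemma blocked_raise (s s' : C -> R) (x : C) :
  (forall y, s y <= s' y) -> (forall y, w y = 0 -> s' y = s y) ->
  s' x = s x -> (forall j, load s' j <= k j) -> blocked s x -> blocked s' x.
Proof.
move=> ss' s'0 eqx feas [j [tj cj mj]]; exists j.
have tj' : load s' j = k j.
  by apply/le_anti; rewrite feas -tj ler_load.
split => //; first by rewrite eqx.
move=> y lt; rewrite eqx; have [w0|w0] := eqVneq (w y) 0.
  by move: lt; rewrite s'0//; exact: mj.
have wy : 0 < w y by rewrite lt_neqAle eq_sym w0 w_ge0.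
have eqy : s y = s' y.
  by apply: (eq_load_contrib ss' _ wy lt); rewrite tj tj'.
by rewrite -eqy; apply: mj; rewrite eqy.
Qed.

(* Induction on the number of clients not in the frozen set A, which all sit at
   the common current level l. *)
Lemma dual_ascent (j0 : J) :
  exists2 s : C -> R, forall j, load s j <= k j &
    forall x, 0 < w x -> blocked s x.
Proof.
suff H n (A : {set C}) (s : C -> R) (l : R) : (#|~: A| <= n)%N ->
    (forall x, s x <= l) ->
    (forall x, x \notin A -> s x = l /\ 0 < w x) ->
    (forall j, load s j <= k j) ->
    (forall x, x \in A -> 0 < w x -> blocked s x) ->
    exists2 s : C -> R, forall j, load s j <= k j &
      forall x, 0 < w x -> blocked s x.
  (* Start below every [g j x], where all loads vanish; clients of weight zero are frozen from the
     outset. *)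
  pose l := \big[Order.min/0]_(z : J * C) g z.1 z.2.
  have lg j x : l <= g j x by apply: (bigmin_le_cond _ (j := (j, x))).
  apply: (H _ [set x | ~~ (0 < w x)] (fun=> l) l (leqnn _)).
  - by [].
  - by move=> x; rewrite inE negbK.
  - move=> j; rewrite /load big1// => x _.
    by rewrite (max_idPl _) ?mulr0// subr_le0.
  - by move=> x; rewrite inE => /negP.
elim: n => [|n IH] in A s l *.
  rewrite leqn0 cards_eq0 => /eqP A0 _ _ feas bl; exists s => // x; apply: bl.
  by rewrite -[A]finset.setCK A0 finset.setC0 inE.
move=> cardA sle1 sl feas bl.
have [A0|AN0] := eqVneq (~: A) set0.
  exists s => // x; apply: bl.
  by rewrite -[A]finset.setCK A0 finset.setC0 inE.
pose upd m x := if x \in A then s x else m.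
have loadE m j : load (upd m) j = \sum_(x in A) w x * Num.max 0 (s x - g j x)
    + \sum_(x in ~: A) w x * Num.max 0 (m - g j x).
  rewrite /load (bigID (mem A))/=; congr (_ + _).
    by apply: eq_bigr => x xA; rewrite /upd xA.
  apply: eq_big => [x|x xA]; first by rewrite inE.
  by rewrite /upd (negbTE xA).
have updl : upd l =1 s.
  by move=> x; rewrite /upd; case: ifPn => // /sl[].
have loadl j : load (upd l) j = load s j.
  by apply: eq_bigr => x _; rewrite updl.
have Aw x : x \in ~: A -> 0 < w x by rewrite inE => /sl[].
have Hm j : exists m, [/\ load (upd m) j = k j,
    exists2 x, x \in ~: A & g j x <= m &
    forall m', load (upd m') j <= k j -> m' <= m].
  have [|m [e1 e2 e3]] := @filling_level w (g j) (~: A)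
      (\sum_(x in A) w x * Num.max 0 (s x - g j x)) (k j) Aw AN0.
    apply: le_trans (feas j); rewrite -loadl loadE lerDl sumr_ge0// => x _.
    by rewrite mulr_ge0// le_max lexx.
  by exists m; split=> [||m']; rewrite ?loadE//; exact: e3.
have [m {}Hm] := boolp.choice Hm.
(* [j1] is the first facility to become tight as the level rises; a rising client [x1] within its
   reach gets frozen. *)
pose j1 := [arg min_(j < j0) m j]%O.
have mmin j : m j1 <= m j.
  by rewrite /j1; case: Order.TotalTheory.arg_minP => // i _; exact.
have [t1 [x1 x1A gx1] _] := Hm j1.
have updm a b x : a <= b -> upd a x <= upd b x.
  by move=> ab; rewrite /upd; case: ifP.
have lm : l <= m j1 by have [_ _] := Hm j1; apply; rewrite loadl.
have feas' j : load (upd (m j1)) j <= k j.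
  have [<- _ _] := Hm j; apply: ler_load => x; exact: updm.
have sle x : s x <= upd (m j1) x by rewrite -updl updm.
apply: (IH (x1 |: A) (upd (m j1)) (m j1)) => //.
- have -> : ~: (x1 |: A) = (~: A) :\ x1.
    by apply/setP => x; rewrite !inE negb_or.
  by move: cardA; rewrite (cardsD1 x1) x1A.
- by move=> x; rewrite /upd; case: ifP => // _; exact: le_trans lm.
- by move=> x; rewrite !inE negb_or => /andP[_ xA]; rewrite /upd (negbTE xA);
    split=> //; exact: (sl _ xA).2.
- move=> x; rewrite in_setU1 => /orP[/eqP-> _|xA wx].
    have updx1 : upd (m j1) x1 = m j1.
      by move: x1A; rewrite inE /upd => /negbTE->.
    (* No client lies above the new level [m j1], so no contributor is above [x1]. *)
    exists j1; rewrite updx1; split=> // y _; rewrite /upd; case: ifP => // _.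
    exact: le_trans lm.
  apply: (blocked_raise sle) => //; last exact: bl.
  - move=> y y0; rewrite /upd; case: ifPn => // /sl[_].
    by rewrite y0 ltxx.
  - by rewrite /upd xA.
Qed.

End DualAscent.

(** * Greedy opening and facility location duality *)

Lemma greedy_independent (R : realType) (J : finType) (e : J -> R)
    (conf : rel J) (W : {set J}) :
  reflexive conf -> symmetric conf ->
  exists F : {set J}, [/\ F \subset W,
    {in F &, forall j j', conf j j' -> j = j'} &
    forall j, j \in W -> exists2 j', j' \in F & conf j j' /\ e j' <= e j].
Proof.
move=> cr cs; have [n] := ubnP #|W|; elim: n => // n IH in W *.
rewrite ltnS => cardW; have [->|/set0Pn[z zW]] := eqVneq W set0.
  exists set0; split=> [|j j'|j]; rewrite ?sub0set// inE//.
(* Keep [j0], discard all that conflicts with it and recurse; whatever is discarded is dominated by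
   [j0]. *)
pose j0 := [arg min_(j < z in W) e j]%O.
have [j0W j0min] : j0 \in W /\ forall j, j \in W -> e j0 <= e j.
  by rewrite /j0; case: Order.TotalTheory.arg_minP => // j jW jm; split.
pose W' := [set j in W | ~~ conf j j0].
have [|F [FW Find Fdom]] := IH W'.
  apply: leq_trans cardW; apply: proper_card; apply/properP; split.
    by apply/subsetP => j; rewrite inE => /andP[].
  by exists j0; rewrite // inE cr andbF.
have nF j : j \in F -> ~~ conf j j0.
  by move=> /(subsetP FW); rewrite inE => /andP[].
exists (j0 |: F); split.
- rewrite finset.subUset sub1set j0W; apply/subsetP => j /(subsetP FW).
  by rewrite inE => /andP[].
- move=> j j'; rewrite !in_setU1 => /orP[/eqP->|jF] /orP[/eqP->|jF']//.
  + by rewrite cs (negbTE (nF _ jF')).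
  + by rewrite (negbTE (nF _ jF)).
  + exact: Find.
- move=> j jW; case: (boolP (conf j j0)) => [cj|ncj].
    by exists j0; [rewrite in_setU1 eqxx | split=> //; exact: j0min].
  have [|j' jF' H] := Fdom j; first by rewrite inE jW.
  by exists j'; rewrite // in_setU1 jF' orbT.
Qed.

(** Each client contributes to at most one open facility, so the tight constraints over [F] split
    the opening costs exactly into the amounts [w x * (s x - g (a x) x)]. *)
Lemma facility_location_duality (R : realType) (C J : finType) (j0 : J)
    (w : C -> R) (g : J -> C -> R) (k e : J -> R) :
  (forall x, 0 <= w x) -> (forall j, 0 <= k j) ->
  (forall j j' x x', e j' <= e j -> g j' x <= Num.max (g j x) (g j' x')) ->
  exists s : C -> R, exists F : {set J}, exists a : C -> J,
  [/\ forall j, load w g s j <= k j,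
      forall x, 0 < w x -> a x \in F &
      \sum_(j in F) k j + \sum_x w x * g (a x) x = \sum_x w x * s x].
Proof.
move=> w0 k0 ge.
have [s feas bl] := dual_ascent g w0 k0 j0.
pose contrib j x := (0 < w x) && (g j x < s x).
pose conf j j' := (j == j') || [exists x, contrib j x && contrib j' x].
pose W := [set j | load w g s j == k j].
have [||F [FW Find Fdom]] := @greedy_independent R J e conf W.
- by move=> j; rewrite /conf eqxx.
- move=> j j'; rewrite /conf eq_sym; congr (_ || _).
  by apply: eq_existsb => x; rewrite andbC.
(* If [j] was skipped for [j'], a common contributor [y] has [g j' y < s y <= s x]; with
   [g j x <= s x], hypothesis [ge] bounds [g j' x]. *)
have cover x : 0 < w x -> exists2 j, j \in F & g j x <= s x.
  move=> wx; have [j [tj cj mj]] := bl x wx.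
  have [|j' jF' [/orP[/eqP jj'|/existsP[y /andP[/andP[_ cy] /andP[_ cy']]]] ej]] :=
      Fdom j.
  - by rewrite inE tj.
  - by exists j' => //; rewrite -jj'.
  - exists j' => //; apply: le_trans (ge _ _ x y ej) _; rewrite ge_max cj/=.
    exact/(le_trans (ltW cy'))/mj.
(* Choose the open facility to which [x] contributes, or any open one within reach if there is
   none. *)
have Ha x : exists j, 0 < w x -> [/\ j \in F, g j x <= s x &
    forall j', j' \in F -> j' != j -> s x <= g j' x].
  have [wx|_] := ltP 0 (w x); last by exists j0.
  case: (pickP [pred j in F | g j x < s x]) => [j /andP[jF jx]|none].
    exists j => _; split=> // [|j' jF' ne]; first exact: ltW.
    rewrite leNgt; apply/negP => lt; case/eqP: ne.
    apply: Find => //; apply/orP; right; apply/existsP; exists x.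
    by rewrite /contrib wx lt jx.
  have [j jF jx] := cover x wx; exists j => _; split=> // j' jF' _.
  by move/(_ j'): none; rewrite /= jF' /= => /negbT; rewrite -leNgt.
have [a {}Ha] := boolp.choice Ha.
exists s, F, a; split=> // [x /Ha[]//|].
have -> : \sum_(j in F) k j = \sum_x w x * (s x - g (a x) x).
  transitivity (\sum_(j in F) load w g s j).
    by apply: eq_bigr => j /(subsetP FW); rewrite inE => /eqP.
  rewrite /load exchange_big /=; apply: eq_bigr => x _.
  have [wx|] := ltP 0 (w x); last first.
    move=> wx; have -> : w x = 0 by apply/le_anti; rewrite wx w0.
    by rewrite mul0r big1// => j _; rewrite mul0r.
  have [aF ax amin] := Ha x wx.
  rewrite (bigD1 (a x))//= (max_idPr _) ?subr_ge0// big1 ?addr0// => j.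
  by move=> /andP[jF jne]; rewrite (max_idPl _) ?mulr0// subr_le0 amin.
by rewrite -big_split /=; apply: eq_bigr => x _; rewrite -mulrDr subrK.
Qed.

(** * Lot sizing as facility location *)

Section LotSizing.
Variables (R : realType) (T : nat) (p h b k : 'I_T -> R).
Hypotheses (p_ge0 : forall t, 0 <= p t) (h_ge0 : forall t, 0 <= h t)
  (b_ge0 : forall t, 0 <= b t) (k_ge0 : forall t, 0 <= k t).

Definition cumul (f : 'I_T -> R) (m : nat) : R := \sum_(t < T | (t < m)%N) f t.

Lemma ler_cumul (f : 'I_T -> R) (m n : nat) :
  (forall t, 0 <= f t) -> (m <= n)%N -> cumul f m <= cumul f n.
Proof.
move=> f0 mn; rewrite /cumul [leLHS]big_mkcond [leRHS]big_mkcond /=.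
apply: ler_sum => t _; case: ifP => [tm|_]; last by case: ifP.
by rewrite (leq_trans tm mn).
Qed.

Lemma cumulS (f : 'I_T -> R) (t : 'I_T) : cumul f t.+1 = cumul f t + f t.
Proof.
rewrite /cumul (bigD1 t) ?leqnn//= addrC; congr (_ + _); apply: eq_bigl => u.
by rewrite ltnS ltn_neqAle andbC.
Qed.

Lemma sum_window (f : 'I_T -> R) (m n : nat) :
  \sum_(t < T | (m <= t < n)%N) f t =
  if (m <= n)%N then cumul f n - cumul f m else 0.
Proof.
case: leqP => mn; last by rewrite big_pred0// => t; apply/negP; lia.
rewrite /cumul [in RHS](bigID (fun t : 'I_T => (t < m)%N)) /= addrAC.
have -> : \sum_(t < T | (t < n)%N && (t < m)%N) f t = \sum_(t < T | (t < m)%N) f t.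
  by apply: eq_bigl => t; apply/idP/idP; lia.
by rewrite subrr add0r; apply: eq_bigl => t; apply/idP/idP; lia.
Qed.

(* t is a period, but u ranges over all times, including u = T, so that the
   potentials in lot_cost_lower_bound are defined up to the final time. *)
Definition unit_cost (t : 'I_T) (u : nat) : R :=
  p t + if (t <= u)%N then cumul h u - cumul h t else cumul b t - cumul b u.

(** Going on from [u] to [v] costs holding, from [v] to [u] backlogging. This may be a detour, hence
    inequalities. *)
Lemma unit_cost_triangle (t : 'I_T) (u v : nat) : (u <= v)%N ->
  unit_cost t v <= unit_cost t u + (cumul h v - cumul h u) /\
  unit_cost t u <= unit_cost t v + (cumul b v - cumul b u).
Proof.
move=> uv; have hm := ler_cumul h_ge0; have bm := ler_cumul b_ge0.
have := hm _ _ uv; have := bm _ _ uv; rewrite /unit_cost.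
have [tu|/ltnW ut] := leqP t u.
  by rewrite (leq_trans tu uv); move=> *; split; lra.
have := hm _ _ ut; have := bm _ _ ut.
by have [/[dup]/hm ? /bm ?|/ltnW/[dup]/hm ? /bm ?] := leqP t v;
  move=> *; split; lra.
Qed.

(** If [t' <= u], both periods are compared through holding costs alone, which only underestimates
    the cost from [t]. If [u < t'], the left side is [p t' + cumul b t'], the minimum over [v] of
    [unit_cost t' v + cumul b v]. *)
Lemma unit_cost_order (t t' : 'I_T) (u v : nat) :
  p t' - cumul h t' <= p t - cumul h t ->
  unit_cost t' u + cumul b u <=
  Num.max (unit_cost t u + cumul b u) (unit_cost t' v + cumul b v).
Proof.
move=> e; rewrite le_max; have hm := ler_cumul h_ge0; have bm := ler_cumul b_ge0.
apply/orP; have [t'u|/ltnW ut'] := leqP t' u; [left|right]; rewrite /unit_cost.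
  rewrite t'u; have [_|/ltnW/[dup]/hm ? /bm ?] := leqP t u; lra.
have := hm _ _ ut'; have := bm _ _ ut'; have [ut|_] := leqP t' u.
  by have [/[dup]/hm ? /bm ?|/ltnW/[dup]/hm ? /bm ?] := leqP t' v;
    move: (hm _ _ ut) (bm _ _ ut); lra.
by have [/[dup]/hm ? /bm ?|/ltnW/[dup]/hm ? /bm ?] := leqP t' v; lra.
Qed.

(** Prices and demand are decoupled from coalitions, so that a plan of [S] can be priced at the
    minima of [N]. *)
Definition lot_cost (x : plan T) : R :=
  \sum_(t < T)
    (p t * (order_qty x t)%:R
     + h t * (inventory x (time_after t))%:R
     + b t * (backlogged x (time_after t))%:R
     + k t * (gamma (order_qty x t))%:R).

Definition meets (d : 'I_T -> nat) (x : plan T) : Prop :=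
  [/\ inventory x ord0 = 0%N /\ inventory x ord_max = 0%N,
      backlogged x ord0 = 0%N /\ backlogged x ord_max = 0%N &
      forall t : 'I_T,
        (inventory x (time_after t))%:Z - (backlogged x (time_after t))%:Z =
        (inventory x (time_before t))%:Z - (backlogged x (time_before t))%:Z
        + (order_qty x t)%:Z - (d t)%:Z].

(** Time [m] follows period [m - 1] and precedes period [m]: demand of [u] is in stock then if
    ordered before [m] and due at [m] or later. *)
Definition assignment_plan (d : 'I_T -> nat) (a : 'I_T -> 'I_T) : plan T :=
  Plan (fun t => \sum_(u | a u == t) d u)%N
    (fun m => \sum_(u : 'I_T | (a u < m <= u)%N) d u)%N
    (fun m => \sum_(u : 'I_T | (u < m <= a u)%N) d u)%N.

Lemma assignment_plan_meets (d : 'I_T -> nat) (a : 'I_T -> 'I_T) :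
  meets d (assignment_plan d a).
Proof.
split=> [||t] /=.
- by split; apply: big_pred0 => u; apply/negP => /=; move: (ltn_ord u); lia.
- by split; apply: big_pred0 => u; apply/negP => /=; move: (ltn_ord (a u)); lia.
rewrite /bump /= add1n.
have to_int (i i' e e' q m : nat) : (i' + e + m = i + e' + q)%N ->
  i'%:Z - e'%:Z = i%:Z - e%:Z + q%:Z - m%:Z by lia.
apply: to_int.
(* With [d t] also a sum over [u], the balance can be checked for each demand period separately. *)
have -> : d t = (\sum_(u < T | u == t) d u)%N by rewrite big_pred1_eq.
rewrite [X in (X + _ + _)%N = _]big_mkcond [X in (_ + X + _)%N = _]big_mkcond.
rewrite [X in (_ + _ + X)%N = _]big_mkcond [X in _ = (X + _ + _)%N]big_mkcond.
rewrite [X in _ = (_ + X + _)%N]big_mkcond [X in _ = (_ + _ + X)%N]big_mkcond.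
rewrite -!big_split /=; apply: eq_bigr => u _.
by rewrite -!val_eqE /=; do 6?[case: ifP => ?]; lia.
Qed.

(** Only an inequality, as no demand need be assigned to some periods of [F]. *)
Lemma assignment_plan_cost (d : 'I_T -> nat) (a : 'I_T -> 'I_T) (F : {set 'I_T}) :
  (forall t, (0 < d t)%N -> a t \in F) ->
  lot_cost (assignment_plan d a) <=
  \sum_(t in F) k t + \sum_(t < T) (d t)%:R * unit_cost (a t) t.
Proof.
move=> aF; rewrite /lot_cost big_split /= addrC; apply: lerD.
  rewrite [leRHS]big_mkcond /=; apply: ler_sum => t _; case: ifPn => tF.
    by rewrite ler_piMr// /gamma; case: ifP.
  rewrite big1 ?mulr0// => u /eqP au; apply/eqP; rewrite -leqn0 leqNgt.
  by apply/negP => /aF; rewrite au (negbTE tF).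
have swap (f : 'I_T -> R) (r : 'I_T -> 'I_T -> bool) :
    \sum_t f t * (\sum_(u | r t u) d u)%:R = \sum_u (d u)%:R * \sum_(t | r t u) f t.
  under eq_bigr do rewrite natr_sum mulr_sumr.
  rewrite (exchange_big_dep predT)//=; apply: eq_bigr => u _.
  by rewrite mulr_sumr; apply: eq_bigr => t _; rewrite mulrC.
rewrite !big_split /= !swap -!big_split /=; apply: ler_sum => u _.
rewrite -!mulrDr ler_wpM2l// /unit_cost.
rewrite (eq_bigl (pred1 (a u))) => [|t]; last by rewrite eq_sym.
rewrite big_pred1_eq -addrA lerD2l.
under eq_bigl do rewrite /bump /= add1n ltnS.
under [X in _ + X]eq_bigl do rewrite /bump /= add1n ltnS.
rewrite !sum_window; case: leqP => au; case: leqP => ua; try lra.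
- have -> : nat_of_ord (a u) = u by lia.
  lra.
- lia.
Qed.

(** The balance equations are tested against [f]; the boundary terms vanish because stock and
    backlog are zero at times 0 and [T]. *)
Lemma sum_by_parts (d : 'I_T -> nat) (x : plan T) (f : nat -> R) : meets d x ->
  \sum_(t < T) (d t)%:R * f t = \sum_(t < T) (order_qty x t)%:R * f t +
  \sum_(t < T) (f t.+1 - f t) * ((inventory x (time_after t))%:R
                                 - (backlogged x (time_after t))%:R).
Proof.
move=> [[i0 iT] [e0 eT] bal].
pose N (m : 'I_T.+1) : R := (inventory x m)%:R - (backlogged x m)%:R.
have balR t : (d t)%:R =
    (order_qty x t)%:R + N (time_before t) - N (time_after t).
  have /(congr1 (fun z : int => z%:~R : R)) := bal t.
  rewrite !(rmorphD, rmorphN) /= -!pmulrn /N; lra.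
have shift : \sum_(t < T) N (time_before t) * f t =
             \sum_(t < T) N (time_after t) * f t.+1.
  have := erefl (\sum_(m < T.+1) N m * f m).
  rewrite {1}big_ord_recl big_ord_recr /N /= i0 e0 iT eT subrr !mul0r add0r addr0.
  by move=> <-; apply: eq_bigr.
under eq_bigr do rewrite balR mulrBl mulrDl.
rewrite sumrB big_split /= shift -addrA; congr (_ + _).
by rewrite -sumrB; apply: eq_bigr => t _; rewrite /N; ring.
Qed.

(* Weak duality without decomposing the flow: the potential f u, the cheapest
   unit cost from the open periods, bounds the flow costs of the plan. *)
Lemma lot_cost_lower_bound (d d' : 'I_T -> nat) (x : plan T) (y : 'I_T -> R) :
  meets d x -> (forall t, (d t <= d' t)%N) ->
  (forall t, load (fun u => (d' u)%:R) (fun t (u : 'I_T) => unit_cost t u) y t <= k t) ->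
  \sum_(t < T) (d t)%:R * y t <= lot_cost x.
Proof.
move=> mx dd' feas.
have cost0 : 0 <= lot_cost x.
  by apply: sumr_ge0 => t _; rewrite !addr_ge0 ?mulr_ge0.
case: (pickP (fun t => 0 < order_qty x t)%N) => [t0 t0O|noO]; last first.
  suff : \sum_(t < T) (d t)%:R = 0 :> R.
    move/eqP; rewrite psumr_eq0// => /allP d0.
    rewrite big1// => t _; apply/eqP; rewrite mulf_eq0.
    by have := d0 t; rewrite mem_index_enum => /(_ isT) /= ->.
  (* Testing against the constant 1 equates total demand with total orders, here zero. *)
  have := sum_by_parts (fun=> 1) mx.
  under eq_bigr do rewrite mulr1.
  move=> ->; rewrite !big1 ?addr0// => t _; first by rewrite subrr mul0r.
  by move: (noO t); case: (order_qty x t) => //; rewrite mul0r.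
pose O : pred 'I_T := fun t => (0 < order_qty x t)%N.
pose a (u : nat) := [arg min_(t < t0 | O t) unit_cost t u]%O.
pose f u := unit_cost (a u) u.
have [aO fmin] : (forall u, O (a u)) /\ (forall u t, O t -> f u <= unit_cost t u).
  by split=> u; rewrite /f /a; case: Order.TotalTheory.arg_minP.
(* The excess of [y u] over [f u] is covered by the term of [u] in the load of its cheapest open
   period; the other terms are nonnegative. *)
have dual : \sum_(t < T) (d t)%:R * (y t - f t) <=
    \sum_(t < T) k t * (gamma (order_qty x t))%:R.
  apply: (@le_trans _ _ (\sum_(t | O t) load (fun u => (d' u)%:R)
      (fun t (u : 'I_T) => unit_cost t u) y t)).
    rewrite /load exchange_big /=; apply: ler_sum => u _.
    rewrite (bigD1 (a u)) ?aO//= ler_wpDr//.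
      by apply: sumr_ge0 => t _; apply: mulr_ge0; rewrite // le_max lexx.
    apply: (@le_trans _ _ ((d u)%:R * Num.max 0 (y u - f u))).
      by rewrite ler_wpM2l// le_max lexx orbT.
    by apply: ler_wpM2r; rewrite ?le_max ?lexx// ler_nat.
  rewrite big_mkcond /=; apply: ler_sum => t _; rewrite /gamma /O.
  by case: ifP => _; rewrite ?mulr1 ?mulr0.
(* In one step the potential [f] rises by at most [h t] and falls by at most [b t]. *)
have flow : \sum_(t < T) (d t)%:R * f t <= \sum_(t < T)
    (p t * (order_qty x t)%:R + h t * (inventory x (time_after t))%:R
     + b t * (backlogged x (time_after t))%:R).
  rewrite (sum_by_parts f mx) -big_split /=; apply: ler_sum => t _.
  rewrite -[leRHS]addrA; apply: lerD.
    case: (posnP (order_qty x t)) => [->|qt]; first by rewrite mul0r mulr0.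
    rewrite mulrC ler_wpM2r//; apply: le_trans (fmin t t qt) _.
    by rewrite /unit_cost leqnn subrr addr0.
  have [_ hb] := unit_cost_triangle (a t.+1) (leqnSn t).
  have [hh _] := unit_cost_triangle (a t) (leqnSn t).
  have fS := fmin t.+1 (a t) (aO t); have fs := fmin t (a t.+1) (aO t.+1).
  move: hb hh; rewrite !cumulS -!/(f _) => hb hh.
  have dh : f t.+1 - f t <= h t by lra.
  have db : f t - f t.+1 <= b t by lra.
  have := ler_wpM2r (ler0n R (inventory x (time_after t))) dh.
  by have := ler_wpM2r (ler0n R (backlogged x (time_after t))) db; lra.
have split_y : \sum_(t < T) (d t)%:R * (y t - f t) =
    \sum_(t < T) (d t)%:R * y t - \sum_(t < T) (d t)%:R * f t.
  by rewrite -sumrB; apply: eq_bigr => t _; ring.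
by rewrite /lot_cost big_split /=; lra.
Qed.

Lemma lot_sizing_duality (d : 'I_T -> nat) : (0 < T)%N ->
  exists2 y : 'I_T -> R,
    forall t, load (fun u => (d u)%:R) (fun t (u : 'I_T) => unit_cost t u) y t <= k t &
    exists2 x, meets d x & lot_cost x <= \sum_(t < T) (d t)%:R * y t.
Proof.
move=> T0.
have [|//||s [F [a [feas aF eqs]]]] := @facility_location_duality R 'I_T 'I_T
    (Ordinal T0) (fun u => (d u)%:R) (fun t u => unit_cost t u + cumul b u) k
    (fun t => p t - cumul h t).
- by [].
- by move=> t t' u v; exact: unit_cost_order.
(* Removing the shift [cumul b u] from both levels and costs leaves the loads unchanged. *)
exists (fun u => s u - cumul b u) => [t|].
  apply: le_trans (feas t); rewrite le_eqVlt; apply/orP; left; apply/eqP.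
  by apply: eq_bigr => u _; congr (_ * Num.max _ _); ring.
exists (assignment_plan d a); first exact: assignment_plan_meets.
apply: le_trans (assignment_plan_cost (F := F) _) _.
  by move=> t dt; apply: aF; rewrite ltr0n.
have -> : \sum_(t < T) (d t)%:R * (s t - cumul b t) =
    \sum_(t < T) (d t)%:R * s t - \sum_(t < T) (d t)%:R * cumul b t.
  by rewrite -sumrB; apply: eq_bigr => t _; ring.
rewrite -eqs lerBrDr -addrA lerD2l -big_split /=.
by apply: ler_sum => t _; rewrite -mulrDr.
Qed.

End LotSizing.

(** * Coalition prices and balancedness *)

Lemma coalition_min_ge0 (R : realType) (n T : nat) (A : 'M[R]_(n, T))
    (S : {set 'I_n}) (t : 'I_T) :
  (forall i t, 0 <= A i t) -> 0 <= coalition_min A S t.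
Proof.
move=> A0; have [->|/(coalition_minP A t)[[i _ ->] _]//] := eqVneq S set0.
by rewrite /coalition_min; case: pickP => // j; rewrite inE.
Qed.

Lemma coalition_min_subset (R : realType) (n T : nat) (A : 'M[R]_(n, T))
    (S S' : {set 'I_n}) (t : 'I_T) :
  S != set0 -> S \subset S' -> coalition_min A S' t <= coalition_min A S t.
Proof.
move=> S0 SS'; have [[i iS ->] _] := coalition_minP A t S0.
have iS' := subsetP SS' _ iS.
by have [_] := coalition_minP A t (introT (set0Pn _) (ex_intro _ i iS')); apply.
Qed.

Theorem theorem3p3 (R : realType) (n T : nat) (hT : (1 <= T)%N)
    (s : si_situation R n T) :
  balanced (si_game s).
Proof.
move=> B lambda B0 l0 l1; set N := [set: 'I_n].
have [N0|NN0] := eqVneq N set0.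
  rewrite {1}/si_game N0 eqxx big1// => S SB; case/negP: B0.
  suff <- : S = set0 by [].
  by apply/eqP; rewrite -subset0 -N0 subsetT.
pose cm (A : 'M[R]_(n, T)) t : R := coalition_min A N t.
have cm0 (A : 'M[R]_(n, T)) t : (forall i t, 0 <= A i t) -> 0 <= cm A t.
  exact: coalition_min_ge0.
have p0 t := cm0 _ t (purchase_ge0 s); have h0 t := cm0 _ t (holding_ge0 s).
have b0 t := cm0 _ t (backlog_ge0 s); have k0 t := cm0 _ t (setup_ge0 s).
have [y feas [x mx cx]] := lot_sizing_duality (cm (purchase s)) h0 b0 k0
  (coalition_demand s N) hT.
have [xN _ [-> minN]] := si_game_attained s NN0.
apply: le_trans (minN x mx) _; apply: le_trans cx _.
(* Demand is additive over players, and each player is counted with total weight 1. *)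
have -> : \sum_(t < T) (coalition_demand s N t)%:R * y t =
    \sum_(S in B) lambda S * \sum_(t < T) (coalition_demand s S t)%:R * y t.
  under [RHS]eq_bigr do rewrite mulr_sumr.
  rewrite exchange_big /=; apply: eq_bigr => t _.
  under eq_bigr do rewrite mulrA.
  rewrite -mulr_suml; congr (_ * _); rewrite natr_sum.
  under [RHS]eq_bigr do rewrite natr_sum mulr_sumr.
  rewrite (exchange_big_dep (mem N)) /= => [|? ? _ _]; last by rewrite inE.
  by apply: eq_bigr => i _; rewrite -mulr_suml l1 mul1r.
apply: ler_sum => S SB; rewrite ler_wpM2l ?l0//.
have S0 : S != set0 by apply: contraNneq B0 => <-.
have [xS mS [-> _]] := si_game_attained s S0.
(* The plan of [S] is first priced at the minima of [N], where weak duality applies; the minima over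
   [S] are no smaller. *)
apply: (@le_trans _ _ (lot_cost (cm (purchase s)) (cm (holding s))
    (cm (backlog s)) (cm (setup s)) xS)).
  apply: (lot_cost_lower_bound p0 h0 b0 k0 mS _ feas) => t.
  by rewrite /coalition_demand [leqRHS](big_setID S)/= setTI leq_addr.
apply: ler_sum => t _.
by do 3?apply: lerD; apply: ler_wpM2r => //; apply: coalition_min_subset;
  rewrite ?subsetT.
Qed.
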